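(* Let $d\geq 1$ and let $G$ be a finite simple $d$-regular graph that is Vizing-class-1 (i.e. $\chi'(G)=d$). Then every proper edge coloring $c:E(G)\rightarrow\{1,2,\ldots,d\}$ is an additive edge coloring of $G$. Consequently $\eta_p'(G)=\chi'(G)=d$, and in particular $\eta(L(G))\leq \chi(L(G))$, where $L(G)$ is the line graph of $G$.
   Context: All graphs are finite, with no loops and no parallel edges. For an edge $e$ of $G$, $N'(e)$ denotes the set of edges of $G$ other than $e$ that share an endpoint with $e$. An additive edge coloring of $G$ is a function $c:E(G)\rightarrow\mathbb{N}$ (positive integers) such that for any two edges $e_1,e_2$ sharing an endpoint, $\sum_{e\in N'(e_1)}c(e)\neq\sum_{e\in N'(e_2)}c(e)$; equivalently, an additive coloring of the line graph $L(G)$, where an additive coloring of a graph $H$ is a map $c:V(H)\to\mathbb{N}$ with $\sum_{u\in N(v)}c(u)\neq\sum_{u\in N(w)}c(u)$ for all adjacent $v,w$. A proper additive edge coloring is an additive edge coloring that is also a proper edge coloring. $\eta_p'(G)$ is the least $k$ such that $G$ has a proper additive edge coloring with labels in $\{1,\ldots,k\}$; $\eta(H)$ is the least $k$ such that $H$ has an additive coloring with labels in $\{1,\dots,k\}$. $\chi'(G)$ is the chromatic index and $\chi$ the chromatic number. A $d$-regular graph is Vizing-class-1 if $\chi'(G)=d$. *)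

(* Defs.v *)
From mathcomp Require Import all_boot.

Set Implicit Arguments.
Unset Strict Implicit.
Unset Printing Implicit Defensive.

Record sgraph := SGraph {
  vertex :> finType;
  adj : rel vertex;
  adj_sym : symmetric adj;
  adj_irrefl : irreflexive adj }.

Definition nbhd (H : sgraph) (v : H) : {set H} := [set u | adj v u].

Definition regular (d : nat) (G : sgraph) : Prop :=
  forall v : G, #|nbhd v| = d.

Definition edges (G : sgraph) : {set {set G}} :=
  [set [set p.1; p.2] | p : G * G & adj p.1 p.2].

Definition edge (G : sgraph) : finType := {A : {set G} | A \in edges G}.

Definition ends (G : sgraph) (e : edge G) : {set G} := sval e.

Definition incident (G : sgraph) : rel (edge G) :=
  fun e f => (e != f) && ~~ [disjoint ends e & ends f].

(* The set N'(e). *)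
Definition edge_nbhd (G : sgraph) (e : edge G) : {set edge G} :=
  [set f | incident e f].

Lemma incident_sym (G : sgraph) : symmetric (@incident G).
Proof. by move=> e f; rewrite /incident eq_sym disjoint_sym. Qed.

Lemma incident_irrefl (G : sgraph) : irreflexive (@incident G).
Proof. by move=> e; rewrite /incident eqxx. Qed.

Definition line_graph (G : sgraph) : sgraph :=
  SGraph (@incident_sym G) (@incident_irrefl G).

Section Colorings.

Variable H : sgraph.

Definition proper_coloring (C : eqType) (c : H -> C) : bool :=
  [forall v, forall w, adj v w ==> (c v != c w)].

Definition additive_coloring (c : H -> nat) : bool :=
  [forall v, 0 < c v] &&
  [forall v, forall w, adj v w ==>
     (\sum_(u in nbhd v) c u != \sum_(u in nbhd w) c u)].

End Colorings.

Section EdgeColorings.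

Variable G : sgraph.

Definition proper_edge_coloring (C : eqType) (c : edge G -> C) : bool :=
  [forall e, forall f, incident e f ==> (c e != c f)].

Definition additive_edge_coloring (c : edge G -> nat) : bool :=
  [forall e, 0 < c e] &&
  [forall e, forall f, incident e f ==>
     (\sum_(g in edge_nbhd e) c g != \sum_(g in edge_nbhd f) c g)].

End EdgeColorings.

Definition colorable (H : sgraph) (k : nat) : bool :=
  [exists c : {ffun H -> 'I_k}, proper_coloring c].

Definition edge_colorable (G : sgraph) (k : nat) : bool :=
  [exists c : {ffun edge G -> 'I_k}, proper_edge_coloring c].

(* Additive colorings are positive, so maps into 'I_k.+1 here and in
   proper_additive_edge_colorable are labelings by {1, ..., k}. *)
Definition additive_colorable (H : sgraph) (k : nat) : bool :=
  [exists c : {ffun H -> 'I_k.+1}, additive_coloring (fun v => c v : nat)].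

Definition proper_additive_edge_colorable (G : sgraph) (k : nat) : bool :=
  [exists c : {ffun edge G -> 'I_k.+1},
     proper_edge_coloring c && additive_edge_coloring (fun e => c e : nat)].

Section Existence.

Lemma binary_inj n (a b : nat -> bool) :
  \sum_(i < n) a i * 2 ^ i = \sum_(i < n) b i * 2 ^ i ->
  forall i, i < n -> a i = b i.
Proof.
elim: n a b => [//|n IH] a b; rewrite !big_ord_recl /= !expn0 !muln1.
have half (f : nat -> bool) :
    \sum_(i < n) f (bump 0 i) * 2 ^ bump 0 i =
    (\sum_(i < n) f i.+1 * 2 ^ i).*2.
  rewrite -mul2n big_distrr; apply: eq_bigr => i _ /=.
  by rewrite /bump /= add1n expnS mulnCA.
rewrite !half => E.
have E0 : a 0 = b 0.
  by have := congr1 odd E; rewrite !oddD !odd_double !addbF !oddb.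
have E1 : \sum_(i < n) a i.+1 * 2 ^ i = \sum_(i < n) b i.+1 * 2 ^ i.
  by apply: double_inj; move/eqP: E; rewrite E0 eqn_add2l => /eqP.
by case=> [//|i]; rewrite ltnS => lt_in; apply: (IH (a \o succn) (b \o succn)).
Qed.

Lemma pow2_sum_inj (T : finType) (A B : {set T}) :
  \sum_(x in A) 2 ^ enum_rank x = \sum_(x in B) 2 ^ enum_rank x -> A = B.
Proof.
pose m (X : {set T}) i :=
  if insub i is Some j then enum_val (j : 'I_#|T|) \in X else false.
have mE X (j : 'I_#|T|) : m X j = (enum_val j \in X) by rewrite /m valK.
have sumE (X : {set T}) :
    \sum_(x in X) 2 ^ enum_rank x = \sum_(j < #|T|) m X j * 2 ^ j.
  rewrite (reindex _ (onW_bij _ (@enum_val_bij T))) big_mkcond.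
  apply: eq_bigr => j _ /=; rewrite mE enum_valK.
  by case: ifP => _; rewrite ?mul1n ?mul0n.
rewrite !sumE => /binary_inj eqAB; apply/setP => x.
by have := eqAB _ (ltn_ord (enum_rank x)); rewrite !mE enum_rankK.
Qed.

Definition pow2_label (T : finType) : {ffun T -> 'I_(2 ^ #|T|).+1} :=
  [ffun x => inord (2 ^ enum_rank x)].

Lemma pow2_labelE (T : finType) (x : T) :
  pow2_label T x = 2 ^ enum_rank x :> nat.
Proof. by rewrite ffunE inordK // ltnS leq_exp2l // ltnW. Qed.

Lemma pow2_label_sum (T : finType) (A B : {set T}) :
  A != B -> \sum_(x in A) pow2_label T x != \sum_(x in B) pow2_label T x.
Proof.
apply: contraNneq; rewrite !(eq_bigr _ (fun x _ => pow2_labelE x)).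
by move=> /pow2_sum_inj ->.
Qed.

Lemma pow2_label_inj (T : finType) : injective (pow2_label T).
Proof.
move=> x y /(congr1 (@nat_of_ord _)); rewrite !pow2_labelE => /eqP.
by rewrite eqn_exp2l // => /eqP /val_inj /enum_rank_inj.
Qed.

Lemma colorable_ex (H : sgraph) : exists k, colorable H k.
Proof.
exists #|H|; apply/existsP; exists [ffun v => enum_rank v].
apply/forallP => v; apply/forallP => w; apply/implyP; rewrite !ffunE.
by apply: contraTneq => /enum_rank_inj ->; rewrite adj_irrefl.
Qed.

Lemma edge_colorable_ex (G : sgraph) : exists k, edge_colorable G k.
Proof. exact: colorable_ex (line_graph G). Qed.

Lemma additive_colorable_ex (H : sgraph) : exists k, additive_colorable H k.
Proof.
exists (2 ^ #|H|); apply/existsP; exists (pow2_label H); apply/andP; split.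
  by apply/forallP => v; rewrite pow2_labelE expn_gt0.
apply/forallP => v; apply/forallP => w; apply/implyP => vw.
apply: pow2_label_sum; apply/eqP => /setP /(_ w).
by rewrite !inE vw adj_irrefl.
Qed.

Lemma proper_additive_edge_colorable_ex (G : sgraph) :
  exists k, proper_additive_edge_colorable G k.
Proof.
exists (2 ^ #|edge G|); apply/existsP; exists (pow2_label (edge G)).
apply/and3P; split.
- apply/forallP => e; apply/forallP => f; apply/implyP.
  by apply: contraTneq => /pow2_label_inj ->; rewrite incident_irrefl.
- by apply/forallP => e; rewrite pow2_labelE expn_gt0.
apply/forallP => e; apply/forallP => f; apply/implyP => ef.
apply: pow2_label_sum; apply/eqP => /setP /(_ f).
by rewrite !inE ef incident_irrefl.
Qed.

End Existence.

Definition chromatic_number (H : sgraph) : nat := ex_minn (colorable_ex H).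

Definition chromatic_index (G : sgraph) : nat :=
  ex_minn (edge_colorable_ex G).

(* eta(H) *)
Definition additive_number (H : sgraph) : nat :=
  ex_minn (additive_colorable_ex H).

(* eta_p'(G) *)
Definition proper_additive_index (G : sgraph) : nat :=
  ex_minn (proper_additive_edge_colorable_ex G).

(* Main.v *)
Require Import Defs.
From mathcomp Require Import all_boot.

(** A proper edge coloring with labels [1, ..., d] of a [d]-regular graph uses
    every label exactly once on the edges at a vertex, so these labels have the
    same sum [S] at all vertices. An edge [e] is counted at both of its ends,
    whence the sum over [N'(e)] is [2 S - 2 c(e)], which determines [c(e)]. *)

Set Implicit Arguments.
Unset Strict Implicit.
Unset Printing Implicit Defensive.

Definition star (G : sgraph) (v : G) : {set edge G} := [set e | v \in ends e].

Lemma edgeP (G : sgraph) (e : edge G) :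
  exists u v : G, adj u v /\ ends e = [set u; v].
Proof.
case: e => A /= A_edge; have /imsetP[[u v]] := A_edge.
by rewrite inE => uv defA; exists u, v.
Qed.

Lemma adj_neq (G : sgraph) (u v : G) : adj u v -> u != v.
Proof. by apply: contraTneq => ->; rewrite adj_irrefl. Qed.

Lemma star_ends (G : sgraph) (v : G) :
  [set ends e | e in star v] = [set [set v; u] | u in nbhd v].
Proof.
apply/setP => A; apply/imsetP/imsetP => [[e]|[u]].
  rewrite inE; have [x [y [xy ->]]] := edgeP e.
  rewrite !inE => /orP[] /eqP -> ->; first by exists y; rewrite ?inE.
  by exists x; rewrite ?inE 1?adj_sym // setUC.
rewrite inE => vu ->.
have vu_edge : [set v; u] \in edges G.
  by apply/imsetP; exists (v, u); rewrite ?inE.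
exists (exist (fun B => B \in edges G) _ vu_edge) => //.
by rewrite // inE /ends /= !inE eqxx.
Qed.

(** Edges at [v] correspond to neighbors through [u] ↦ [[set v; u]]. This map is injective because
    [v] is not its own neighbor: from [{v, u} = {v, w}] and [u != v] follows [u = w]. *)
Lemma card_star (G : sgraph) (v : G) : #|star v| = #|nbhd v|.
Proof.
rewrite -(card_imset _ (val_inj : injective (@ends G))) star_ends.
apply: card_in_imset => u w; rewrite !inE => vu vw /setP /(_ u).
rewrite !inE eqxx orbT eq_sym (negPf (adj_neq vu)) /=.
by move/esym/eqP.
Qed.

Lemma star_incident (G : sgraph) (v : G) (e f : edge G) :
  e \in star v -> f \in star v -> e != f -> incident e f.
Proof.
rewrite !inE /incident => ve vf -> /=.
by apply/pred0Pn; exists v; rewrite /= ve vf.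
Qed.

Lemma edge_nbhdE (G : sgraph) (e : edge G) (u v : G) :
  ends e = [set u; v] -> edge_nbhd e = (star u :\ e) :|: (star v :\ e).
Proof.
move=> defe; apply/setP => f; rewrite !inE /incident eq_sym -andb_orr.
congr (_ && _); rewrite defe; apply/pred0Pn/orP => /=.
  by case=> x; rewrite !inE => /andP[/orP[] /eqP -> ->]; [left | right].
by case=> xf; [exists u | exists v]; rewrite !inE eqxx ?orbT.
Qed.

(** There are no parallel edges: an edge has just two ends, so two distinct vertices on it determine
    it. Hence the stars at the two ends of [e] share only [e]. *)
Lemma star_meet (G : sgraph) (e f : edge G) (u v : G) :
  adj u v -> ends e = [set u; v] -> f \in star u -> f \in star v -> f = e.
Proof.
move=> uv defe; rewrite !inE => uf vf; apply: val_inj.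
change (ends f = ends e); rewrite defe; move: uf vf.
have [x [y [xy ->]]] := edgeP f; move: (adj_neq uv); rewrite !inE.
move=> nuv /orP[] /eqP eu /orP[] /eqP ev; subst; rewrite ?eqxx // in nuv *.
by rewrite setUC.
Qed.

Section RegularColoring.

Variables (d : nat) (G : sgraph) (c : edge G -> nat).
Hypotheses (G_regular : regular d G) (c_range : forall e, 1 <= c e <= d).
Hypothesis c_proper : proper_edge_coloring c.

Lemma proper_edge_coloringP (e f : edge G) : incident e f -> c e != c f.
Proof. by move/forallP/(_ e)/forallP/(_ f)/implyP: c_proper. Qed.

Lemma star_sum (v : G) :
  \sum_(e in star v) c e = \sum_(i in [set~ ord0 : 'I_d.+1]) i.
Proof.
(* Labels are at most [d], so [inord] never falls back to its default value. *)
pose c' e : 'I_d.+1 := inord (c e).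
have c'E e : c' e = c e :> nat.
  by rewrite inordK // ltnS; case/andP: (c_range e).
have c'_inj : {in star v &, injective c'}.
  move=> e f ve vf /(congr1 val) /=; rewrite !c'E; apply: contra_eq.
  by move=> /(star_incident ve vf) /proper_edge_coloringP.
(* By regularity the star carries [d] distinct nonzero labels, and ['I_d.+1] has exactly [d] nonzero
   elements. *)
have <- : c' @: star v = [set~ ord0].
  apply/eqP; rewrite eqEcard cardsC1 card_ord card_in_imset //.
  rewrite card_star G_regular leqnn andbT; apply/subsetP => _ /imsetP[e _ ->].
  rewrite !inE -val_eqE /= c'E -lt0n.
  by case/andP: (c_range e).
by rewrite big_imset //; apply: eq_bigr => e _; rewrite c'E.
Qed.

Lemma edge_nbhd_sum (e : edge G) :
  \sum_(f in edge_nbhd e) c f + (c e).*2 =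
  (\sum_(i in [set~ ord0 : 'I_d.+1]) i).*2.
Proof.
have [u [v [uv defe]]] := edgeP e.
have eu : e \in star u by rewrite inE defe !inE eqxx.
have ev : e \in star v by rewrite inE defe !inE eqxx orbT.
rewrite (edge_nbhdE defe) (eq_bigl _ _ (fun f => in_setU f _ _)).
rewrite bigU /=; last first.
  apply/pred0P => f /=; rewrite !in_setD1.
  apply/negP => /andP[/andP[/negP ne fu] /andP[_ fv]].
  by apply: ne; apply/eqP; apply: (star_meet uv defe).
(* One copy of [S] is unfolded at each end of [e], and [c e] is taken out of both. *)
rewrite -!addnn -{1}(star_sum u) -(star_sum v).
by rewrite (big_setD1 _ eu) (big_setD1 _ ev) /= addnACA ![_ + c e]addnC.
Qed.

Lemma regular_proper_additive : additive_edge_coloring c.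
Proof.
apply/andP; split; first by apply/forallP => e; case/andP: (c_range e).
apply/forallP => e; apply/forallP => f; apply/implyP.
move=> /proper_edge_coloringP; apply: contraNneq => eq_sum.
have := edge_nbhd_sum e; rewrite -(edge_nbhd_sum f) eq_sum.
by move/eqP; rewrite eqn_add2l => /eqP /double_inj ->.
Qed.

End RegularColoring.

Lemma chromatic_index_min (G : sgraph) (k : nat) :
  edge_colorable G k -> chromatic_index G <= k.
Proof. by rewrite /chromatic_index; case: ex_minnP => m _; apply. Qed.

(** Additive labels are positive, so lowering each by one keeps them distinct and leaves [k] colors.
    This bounds the proper additive index below by the chromatic index. *)
Lemma proper_additive_edge_colorableW (G : sgraph) (k : nat) :
  proper_additive_edge_colorable G k -> edge_colorable G k.
Proof.
case/existsP => c /and3P[c_proper /forallP c_gt0 _].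
have c_lt e : (c e).-1 < k by rewrite prednK // -ltnS ltn_ord.
apply/existsP; exists [ffun e => Ordinal (c_lt e)].
apply/forallP => e; apply/forallP => f; apply/implyP => ef.
move/forallP/(_ e)/forallP/(_ f)/implyP/(_ ef): c_proper.
rewrite !ffunE; apply: contraNneq => /(congr1 val) /= eq_pred.
by apply/eqP/val_inj; rewrite /= -(prednK (c_gt0 e)) eq_pred prednK.
Qed.

Lemma regular_proper_additive_edge_colorable (d : nat) (G : sgraph) :
  regular d G -> edge_colorable G d -> proper_additive_edge_colorable G d.
Proof.
move=> G_regular /existsP[c /forallP c_proper].
(* [lift ord0] shifts the colors [0, ..., d-1] to the labels [1, ..., d]. *)
pose c1 : {ffun edge G -> 'I_d.+1} := [ffun e => lift ord0 (c e)].
have c1E e : c1 e = (c e).+1 :> nat by rewrite ffunE lift0.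
have c1_proper : proper_edge_coloring (fun e => c1 e : nat).
  apply/forallP => e; apply/forallP => f; rewrite !c1E eqSS.
  exact: (forallP (c_proper e) f).
apply/existsP; exists c1; apply/andP; split=> //.
by apply: regular_proper_additive c1_proper => // e; rewrite c1E ltn_ord.
Qed.

Theorem theorem2p1 (d : nat) (G : sgraph)
    (d_ge1 : 1 <= d) (G_regular : regular d G)
    (G_class1 : chromatic_index G = d) :
  [/\ forall c : edge G -> nat,
        (forall e, 1 <= c e <= d) -> proper_edge_coloring c ->
        additive_edge_coloring c,
      proper_additive_index G = chromatic_index G,
      chromatic_index G = d
    & additive_number (line_graph G) <= chromatic_number (line_graph G)].
Proof.
have d_colorable : edge_colorable G d.
  by rewrite -G_class1 /chromatic_index; case: ex_minnP.
have d_additive := regular_proper_additive_edge_colorable G_regular d_colorable.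
split=> //; first by move=> c; apply: regular_proper_additive.
  apply/eqP; rewrite eqn_leq; apply/andP; split.
    by rewrite G_class1 /proper_additive_index; case: ex_minnP => m _; apply.
  rewrite /proper_additive_index; case: ex_minnP => m m_additive _.
  exact/chromatic_index_min/proper_additive_edge_colorableW.
(* An additive edge coloring of [G] is by conversion an additive coloring of its line graph, so [d]
   labels suffice there. *)
apply: (@leq_trans d).
  rewrite /additive_number; case: ex_minnP => m _; apply.
  by case/existsP: d_additive => c /andP[_ c_additive]; apply/existsP; exists c.
rewrite /chromatic_number; case: ex_minnP => m m_colorable _.
(* A proper coloring of the line graph is by conversion a proper edge coloring of [G]. *)
by rewrite -G_class1; apply: chromatic_index_min m_colorable.
Qed.
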